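(* Let $V$ be a real vector space of dimension $r$, let $\mathcal{A}$ be a finite set of distinct linear hyperplanes in $V$ whose common intersection is $\{0\}$, with a chosen coorientation of each $H\in\mathcal{A}$, and let $\mathbb{F}$ be a field. For every integer $k\geq1$, $\sigma_k=\dim_{\mathbb{F}}\operatorname{VG}_k(\mathcal{A},\mathbb{F})$. In particular, $\mathcal{A}$ satisfies Yoshinaga's criterion if and only if $I_2=I_r$.
   Context: Coorientation: for each $H\in\mathcal{A}$, one of the two connected components of $V\setminus H$ is called $H^+$ and the other $H^-$. For a sign vector $\epsilon\in\{\pm\}^{\mathcal{A}}$ and $S\subseteq\mathcal{A}$, put $H_S^\epsilon=\bigcap_{H\in S}H^{\epsilon_H}$. A sign vector $\epsilon$ is $k$-consistent if $H_S^\epsilon\neq\emptyset$ for every $S\subseteq\mathcal{A}$ with $|S|\leq k+1$; $\Sigma_k$ is the set of $k$-consistent sign vectors and $\sigma_k=|\Sigma_k|$. $\mathcal{A}$ satisfies Yoshinaga's criterion if $\sigma_2=\sigma_r$. Let $R=\mathbb{F}[e_H^+\mid H\in\mathcal{A}]/\langle (e_H^+)^2-e_H^+\mid H\in\mathcal{A}\rangle$, $e_H^-=1-e_H^+$, $f_S^\epsilon=\prod_{H\in S}e_H^{\epsilon_H}$, $g_S^\epsilon=f_S^\epsilon-f_S^{-\epsilon}$. For $k\geq1$, $I_k=\langle g_S^\epsilon\mid H_S^\epsilon=\emptyset,\ |S|\leq k+1\rangle\subseteq R$ and $\operatorname{VG}_k(\mathcal{A},\mathbb{F})=R/I_k$.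 *)

(* Defs.v *)
(* MathComp / MathComp-Analysis *)
From HB Require Import structures.
From mathcomp Require Import all_boot all_order all_algebra.
From mathcomp Require Import finmap.
From mathcomp Require Import classical_sets boolp reals topology.
(* the notations of mpoly clash with those of MathComp-Analysis *)
From mathcomp Require Import -(notations) mpoly.

Set Implicit Arguments.
Unset Strict Implicit.
Unset Printing Implicit Defensive.

Import GRing.Theory VectorInternalTheory.
Import numFieldTopology.Exports.
Local Open Scope classical_set_scope.
Local Open Scope ring_scope.
Local Open Scope quotient_scope.

Section Coorientation.
Variables (R : realType) (V : vectType R).

(* [vectType]s carry no topology in the library: the standard topology of [V] is
   the one transported from 'rV[R]_(dim V) along the coordinate isomorphism. *)
Definition std_topology : topologicalType :=
  initial_topology (@v2r R V : V -> 'rV[R]_(dim V)).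

Definition is_component (B C : set std_topology) : Prop :=
  exists2 x, B x & C = connected_component B x.

(* [half H true] is H^+ and [half H false] is H^-. *)
Definition coorientation (A : {fset {vspace V}}) (half : A -> bool -> set V) :
    Prop :=
  forall H : A,
    [/\ is_component (~` [set` val H]) (half H true),
        is_component (~` [set` val H]) (half H false)
      & half H true <> half H false].

End Coorientation.

(* In the remainder the hyperplanes are indexed by a finite type [I]; a sign
   vector is an element of {ffun I -> bool}, with [true] standing for [+]. *)
Section Signs.
Variables (V : Type) (I : finType) (half : I -> bool -> set V).

Definition half_inter (S : {set I}) (eps : {ffun I -> bool}) : set V :=
  \bigcap_(H in [set` S]) half H (eps H).

Definition consistent (k : nat) (eps : {ffun I -> bool}) : Prop :=
  forall S : {set I}, (#|S| <= k.+1)%N -> half_inter S eps !=set0.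

Definition Sigma (k : nat) : {set {ffun I -> bool}} :=
  [set eps | `[< consistent k eps >]]%SET.

Definition sigma (k : nat) : nat := #|Sigma k|.

Definition yoshinaga (r : nat) : Prop := sigma 2 = sigma r.

End Signs.

Section Ideals.

Definition is_ideal (A : comNzRingType) (J : set A) : Prop :=
  J 0 /\ forall a x y, J x -> J y -> J (a * x + y).

Definition ideal_gen (A : comNzRingType) (G : set A) : set A :=
  smallest (@is_ideal A) G.

Lemma ideal_gen_ideal (A : comNzRingType) (G : set A) : is_ideal (ideal_gen G).
Proof.
split=> [J [[J0 _] _]//|a x y Gx Gy J JG].
by case: (JG) => -[_ +] _; apply; [exact: Gx | exact: Gy].
Qed.

Definition ideal_pred (A : comNzRingType) (G : set A) : {pred A} :=
  fun x => `[< ideal_gen G x >].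

Lemma ideal_predM (A : comNzRingType) (G : set A) (a : A) :
  {in ideal_pred G, forall x, a * x \in ideal_pred G}.
Proof.
have [G0 GM] := ideal_gen_ideal G.
by move=> x /asboolP Gx; apply/asboolP; rewrite -[_ * _]addr0; exact: GM.
Qed.

Lemma ideal_pred_zmod (A : comNzRingType) (G : set A) :
  zmod_closed (ideal_pred G).
Proof.
have [G0 GM] := ideal_gen_ideal G.
split=> [|x y /asboolP Gx /asboolP Gy]; apply/asboolP => //.
by rewrite addrC -mulN1r; exact: GM.
Qed.

Lemma ideal_predZ (K : fieldType) (A : comAlgType K) (G : set A) (a : K) :
  {in ideal_pred G, forall x, a *: x \in ideal_pred G}.
Proof. by move=> x Gx; rewrite -mulr_algl; exact: ideal_predM. Qed.

HB.instance Definition _ (A : comNzRingType) (G : set A) :=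
  GRing.isZmodClosed.Build A (ideal_pred G) (ideal_pred_zmod G).

End Ideals.

(* The library equips a quotient by an ideal with no scalar multiplication. *)
Section QuotientScale.
Variables (K : fieldType) (M : lmodType K) (J : zmodClosed M).
Local Notation Q := {ideal_quot J}.

Definition quot_scale (a : K) : Q -> Q := lift_op1 Q ( *:%R a).

Hypothesis JZ : forall a : K, {in J, forall x, a *: x \in J}.

Lemma pi_scale a : {morph \pi_Q : x / a *: x >-> quot_scale a x}.
Proof.
move=> x; unlock quot_scale; apply/eqP; rewrite piE.
by rewrite Quotient.equivE -scalerBr JZ // Quotient.idealrBE reprK.
Qed.

Lemma quot_scaleA a b x :
  quot_scale a (quot_scale b x) = quot_scale (a * b) x.
Proof. by rewrite -[x]reprK -!pi_scale scalerA. Qed.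

Lemma quot_scale1 : left_id 1 quot_scale.
Proof. by move=> x; rewrite -[x]reprK -pi_scale scale1r. Qed.

Lemma quot_scaleDr : right_distributive quot_scale +%R.
Proof.
by move=> a x y; rewrite -[x]reprK -[y]reprK -raddfD -!pi_scale scalerDr raddfD.
Qed.

Lemma quot_scaleDl x : {morph quot_scale^~ x : a b / a + b}.
Proof. by move=> a b; rewrite -[x]reprK -!pi_scale scalerDl raddfD. Qed.

End QuotientScale.

Section VGring.
Variables (F : fieldType) (I : finType).

(* F[e_H^+ | H : I]: the variables are numbered along the enumeration of [I]. *)
Definition evar (H : I) : mpoly #|I| F := mpolyX F (mnm1 (enum_rank H)).

Definition idem_relations : set (mpoly #|I| F) :=
  [set evar H ^+ 2 - evar H | H in [set: I]].

Definition idem_ideal : {pred mpoly #|I| F} := ideal_pred idem_relations.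

HB.instance Definition _ := GRing.ZmodClosed.on idem_ideal.

Lemma idem_ideal1 : 1 \notin idem_ideal.
Proof.
apply/asboolP => /(_ [set p | meval (fun=> 0) p = 0]) /= G1.
suff: (1 : F) = 0 by move/eqP; rewrite oner_eq0.
rewrite -[LHS](@meval1 #|I| F (fun=> 0)); apply: G1; split.
  split=> [|a x y /= x0 y0]; first exact: meval0.
  by rewrite mevalD mevalM x0 y0 mulr0 addr0.
by move=> _ [H _ <-] /=; rewrite mevalB rmorphXn /= mevalXU expr0n subr0.
Qed.

HB.instance Definition _ :=
  isProperIdeal.Build (mpoly #|I| F) idem_ideal
    (conj idem_ideal1 (@ideal_predM _ idem_relations)).

(* F[e_H^+ | H : I] / <(e_H^+)^2 - e_H^+ | H : I> *)
Definition VGring := {ideal_quot idem_ideal}.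

HB.instance Definition _ := GRing.ComNzRing.on VGring.

Lemma idem_idealZ (a : F) : {in idem_ideal, forall x, a *: x \in idem_ideal}.
Proof. exact: ideal_predZ. Qed.

HB.instance Definition _ :=
  GRing.Zmodule_isLmodule.Build F VGring (quot_scaleA idem_idealZ)
    (quot_scale1 idem_idealZ) (quot_scaleDr idem_idealZ)
    (quot_scaleDl idem_idealZ).

Definition VGpi (p : mpoly #|I| F) : VGring := \pi_VGring p.

Lemma VGpiZ a p : VGpi (a *: p) = a *: VGpi p.
Proof. exact: (pi_scale idem_idealZ). Qed.

Lemma VGpiM p q : VGpi (p * q) = VGpi p * VGpi q.
Proof. exact: (rmorphM (\pi_{ideal_quot idem_ideal})). Qed.

Lemma VGring_scaleAl (a : F) (x y : VGring) : a *: (x * y) = (a *: x) * y.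
Proof.
have VGpiK z : VGpi (repr z) = z by exact: (@reprK _ {ideal_quot idem_ideal}).
by rewrite -[x]VGpiK -[y]VGpiK -VGpiM -!VGpiZ -VGpiM scalerAl.
Qed.

HB.instance Definition _ :=
  GRing.Lmodule_isLalgebra.Build F VGring VGring_scaleAl.
HB.instance Definition _ := GRing.Lalgebra_isComAlgebra.Build F VGring.

Definition VGe (H : I) (s : bool) : VGring :=
  if s then VGpi (evar H) else 1 - VGpi (evar H).

Definition VGf (S : {set I}) (eps : {ffun I -> bool}) : VGring :=
  \prod_(H in S) VGe H (eps H).

Definition VGg (S : {set I}) (eps : {ffun I -> bool}) : VGring :=
  VGf S eps - VGf S [ffun H => ~~ eps H].

End VGring.

Section VG.
Variables (V : Type) (I : finType) (half : I -> bool -> set V) (F : fieldType).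

Definition VG_relations (k : nat) : set (VGring F I) :=
  [set x | exists S eps,
     [/\ half_inter half S eps = set0, (#|S| <= k.+1)%N & x = VGg F S eps]].

Definition VG_ideal (k : nat) : set (VGring F I) := ideal_gen (VG_relations k).

Definition VG (k : nat) := {ideal_quot (ideal_pred (VG_relations k))}.

HB.instance Definition _ (k : nat) := GRing.Zmodule.on (VG k).

Lemma VG_idealZ (k : nat) (a : F) :
  {in ideal_pred (VG_relations k), forall x,
    a *: x \in ideal_pred (VG_relations k)}.
Proof. exact: ideal_predZ. Qed.

HB.instance Definition _ (k : nat) :=
  GRing.Zmodule_isLmodule.Build F (VG k) (quot_scaleA (@VG_idealZ k))
    (quot_scale1 (@VG_idealZ k)) (quot_scaleDr (@VG_idealZ k))
    (quot_scaleDl (@VG_idealZ k)).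

End VG.

Arguments VG_relations {V I} half F k.
Arguments VG_ideal {V I} half F k.
Arguments VG {V I} half F k.

(* M has a basis with n elements *)
Definition has_dim (K : fieldType) (M : lmodType K) (n : nat) : Prop :=
  exists b : 'I_n -> M,
    forall x, exists! c : {ffun 'I_n -> K}, x = \sum_i c i *: b i.

(* Main.v *)
(* Since e_H^+ and e_H^- are orthogonal idempotents with sum 1, the ring is the
   ring of F-valued functions on sign vectors, with the f_A^d as indicator
   functions.  The ideal I_k consists of the functions vanishing on Sigma_k:
   - g_S^e is supported on the d with d = e or d = -e on S, and none of these is
     k-consistent if H_S^e is empty, because v |-> -v exchanges the two sides of
     every hyperplane, hence maps H_S^e onto H_S^{-e};
   - if d is not k-consistent then H_S^d is empty for some small S, which is not
     the empty set, and f_A^d = f_A^d g_S^d is in I_k.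
   So the f_A^d with d in Sigma_k are a basis of VG_k, and I_k determines
   Sigma_k.  As the Sigma_k form a chain, sigma_2 = sigma_r iff I_2 = I_r. *)
From HB Require Import structures.
Require Import Defs.
From mathcomp Require Import all_boot all_order all_algebra.
From mathcomp Require Import finmap classical_sets boolp reals.
From mathcomp Require Import topology normedtype.
From mathcomp Require Import lra.
From mathcomp Require Import -(notations) mpoly.

Set Implicit Arguments.
Unset Strict Implicit.
Unset Printing Implicit Defensive.

Import Order.TTheory GRing.Theory Num.Theory VectorInternalTheory.
Import numFieldTopology.Exports numFieldNormedType.Exports.
Local Open Scope classical_set_scope.
Local Open Scope ring_scope.
Local Open Scope quotient_scope.

(** * Continuity into matrices and into the standard topology of a vector space *)

Lemma continuous_mx (T U : topologicalType) m n (f : T -> 'M[U]_(m, n)) :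
  (forall i j, continuous (fun t => f t i j)) -> continuous f.
Proof.
(* A neighbourhood of a matrix contains a box of neighbourhoods of its finitely many entries. *)
move=> cf t A [P fP PA]; apply: filterS PA _.
apply: filter_forall => i; apply: filter_forall => j.
exact: cf (fP i j).
Qed.

Section Hyperplane.
Variables (R : realType) (V : vectType R).
Local Notation T := (std_topology V).

Lemma continuous_std (U : topologicalType) (f : U -> T) :
  (forall j, continuous (fun t => v2r (f t : V) 0 j)) -> continuous f.
Proof.
move=> cf; apply: continuous_comp_initial; apply: continuous_mx => i j.
by rewrite ord1.
Qed.

Lemma continuous_line (x y : V) :
  continuous ((fun t : R => x + t *: y) : R -> T).
Proof.
apply: continuous_std => j t.
rewrite (_ : (fun _ => _) = (fun t => v2r x 0 j + t * v2r y 0 j)); last first.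
  by apply/funext => u; rewrite linearD linearZ !mxE.
apply: cvgD; first exact: cvg_cst.
by apply: cvgMr_tmp.
Qed.

Lemma continuous_opp_std : continuous (-%R : T -> T).
Proof.
apply: continuous_std => j x.
rewrite (_ : (fun _ => _) = (fun t : T => - (v2r (t : V) 0 j))); last first.
  by apply/funext => u; rewrite linearN !mxE.
apply: cvgN; first exact: (@nbhs_filter T).
apply: (@cvg_comp _ _ _ (@v2r R V : T -> _) (fun M => M 0 j)).
  exact: initial_continuous.
exact: coord_continuous.
Qed.

Lemma connected_component_image (U W : topologicalType) (B : set U) (C : set W)
    (f : U -> W) (x : U) :
  continuous f -> f @` B `<=` C -> B x ->
  f @` connected_component B x `<=` connected_component C (f x).
Proof.
move=> cf fB Bx; apply: connected_component_max.
- by exists x => //; exact: connected_component_refl.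
- apply: subset_trans fB; apply: image_subset.
  exact: connected_component_sub.
- exact: connected_continuous_connected (@component_connected _ B x)
    (continuous_subspaceT cf).
Qed.

(** * Connected components of the complement of a hyperplane *)

Variable H : {vspace V}.
Local Notation B := (~` [set` H] : set T).

(** The segment from $x$ to $y$ is connected and avoids $H$: at time $t$ it is at $th + (1-t+tc)x$,
    and a point of this form in $H$ would put $x$ in $H$. *)
Lemma component_side (x y h : V) (c : R) : ~~ (x \in H) -> h \in H -> 0 < c ->
  y = h + c *: x -> connected_component B x = connected_component B y.
Proof.
move=> xH hH c0 ->; apply: same_connected_component.
pose f (t : R) : T := x + t *: (h + c *: x - x).
have conn : connected (f @` `[0, 1]).
  have cf : continuous f by exact: continuous_line.
  exact: connected_continuous_connected (@segment_connected R 0 1)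
    (continuous_subspaceT cf).
apply: (connected_component_max _ _ conn).
- by exists 0; rewrite /f /= ?scale0r ?addr0 // in_itv /= lexx ler01.
- move=> _ [t /= + <-]; rewrite in_itv /= => /andP[t0 t1] /=.
  have -> : f t = t *: h + (1 - t + t * c) *: x.
    rewrite /f !scalerDr !scalerDl scale1r scalerN scaleNr scalerA -!addrA.
    rewrite [RHS]addrCA; congr (x + _).
    by rewrite [- _ + _]addrC.
  rewrite /= (rpredDl _ (memvZ t hH)) => /(memvZ (1 - t + t * c)^-1).
  rewrite scalerA mulVf ?scale1r; first exact/negP.
  (* The coefficient of $x$ is a convex combination of $1$ and $c$, hence positive. *)
  by rewrite gt_eqF //; nra.
- exists 1; first by rewrite /= in_itv /= lexx ler01.
  by rewrite /f scale1r addrC subrK.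
Qed.

(** Negation is continuous and preserves the complement of $H$. *)
Lemma opp_component (x : V) : ~~ (x \in H) ->
  forall v, connected_component B x v -> connected_component B (- x) (- v).
Proof.
move=> /negP xH v xv; apply: (@connected_component_image _ _ B B -%R x) => //.
- exact: continuous_opp_std.
- by move=> _ [z zB <-] /=; rewrite memvN.
Qed.

Hypothesis dimH : (\dim H).+1 = \dim {:V}.

(** Since $x\notin H$, the line through $x$ meets $H$ only in $0$, and a dimension count gives
    $H+\langle x\rangle=V$. *)
Lemma hyperplane_decomp (x y : V) : ~~ (x \in H) ->
  exists h c, h \in H /\ y = h + c *: x.
Proof.
move=> xH.
have HxV : (H + <[x]>)%VS = fullv.
  apply/eqP; rewrite eqEdim subvf -dimH dimv_disjoint_sum.
    rewrite dim_vline; case: eqP xH => [->|_ _]; first by rewrite mem0v.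
    by rewrite /= addn1.
  apply/eqP; rewrite -subv0; apply/subvP => z /memv_capP[zH /vlineP[a za]].
  case: (eqVneq a 0) za zH => [-> -> _|a0 -> /(memvZ a^-1)].
    by rewrite scale0r mem0v.
  by rewrite scalerA mulVf // scale1r (negPf xH).
have: y \in (H + <[x]>)%VS by rewrite HxV memvf.
by case/memv_addP => h hH [_ /vlineP[c ->] ->]; exists h, c.
Qed.

(* A point off [H] is, modulo [H], a positive multiple of [x] or of [-x]. *)
Lemma component_alternative (x y : V) : ~~ (x \in H) -> ~~ (y \in H) ->
  connected_component B x = connected_component B y \/
  connected_component B (- x) = connected_component B y.
Proof.
move=> xH yH; have [h [c [hH yE]]] := hyperplane_decomp y xH.
have [c0|c0|c0] := ltgtP c 0.
- right; apply: (@component_side _ _ h (- c)); rewrite ?memvN ?oppr_gt0 //.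
  by rewrite scalerN scaleNr opprK.
- by left; exact: component_side yE.
- by move: yH; rewrite yE c0 scale0r addr0 hH.
Qed.

End Hyperplane.

(** Let $x$, $y$ be base points of the two halves. These halves differ, so by
    [component_alternative] the component of $y$ is that of $-x$, and negation exchanges the two. *)
Lemma half_opp (R : realType) (V : vectType R) (A : {fset {vspace V}})
    (half : A -> bool -> set V) :
  (forall H : {vspace V}, H \in A -> (\dim H).+1 = \dim {:V}) ->
  coorientation half ->
  forall H b v, half H b v -> half H (~~ b) (- v).
Proof.
move=> hyp coor H.
have dimH : (\dim (val H)).+1 = \dim {:V} by apply: hyp; exact: valP.
have [[x /= /negP xH tE] [y /= /negP yH fE] ne] := coor H.
pose B : set (std_topology V) := ~` [set` val H].
have {}tE : half H true = connected_component B x := tE.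
have {}fE : half H false = connected_component B y := fE.
have [xy|xy] := component_alternative dimH xH yH.
  by case: ne; rewrite tE fE xy.
case=> v /=; first by rewrite tE fE -xy; exact: opp_component.
rewrite tE fE -xy => /opp_component; rewrite opprK; apply.
by rewrite memvN.
Qed.

(** * Ideals generated by a set *)

Section Ideals.
Variables (A : comNzRingType) (G : set A).

Lemma ideal_gen_sub : G `<=` ideal_gen G.
Proof. exact: sub_smallest. Qed.

Lemma ideal_gen_least (J : set A) :
  is_ideal J -> G `<=` J -> ideal_gen G `<=` J.
Proof. exact: smallest_sub. Qed.

Lemma ideal_gen_sum (I : finType) (P : pred I) (E : I -> A) :
  (forall i, P i -> ideal_gen G (E i)) -> ideal_gen G (\sum_(i | P i) E i).
Proof.
have [G0 GM] := ideal_gen_ideal G.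
by move=> GE; elim/big_ind: _ => // x y Gx Gy; rewrite -[x]mul1r; exact: GM.
Qed.

Lemma ideal_genM (a x : A) : ideal_gen G x -> ideal_gen G (a * x).
Proof.
by have [G0 GM] := ideal_gen_ideal G => Gx; rewrite -[_ * _]addr0; exact: GM.
Qed.

End Ideals.

(** * The ring $R$ as the ring of functions on sign vectors *)

Section VGring.
Variables (F : fieldType) (I : finType).
Local Notation sign := {ffun I -> bool}.
Local Notation VGR := (VGring F I).
Implicit Types (d e : sign) (x y : VGR) (S : {set I}) (H : I).

Lemma VGpiK x : VGpi (repr x) = x.
Proof. exact: (@reprK _ {ideal_quot @idem_ideal F I}). Qed.

Lemma VGpi_eq p q : (VGpi p == VGpi q) = (p - q \in @idem_ideal F I).
Proof. exact: esym (Quotient.idealrBE (@idem_ideal F I) p q). Qed.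

Lemma VGpi_is_zmod_morphism : zmod_morphism (@VGpi F I).
Proof. exact: (rmorphB (\pi_{ideal_quot @idem_ideal F I})). Qed.

Lemma VGpi_is_monoid_morphism : monoid_morphism (@VGpi F I).
Proof.
by split; [exact: (rmorph1 (\pi_{ideal_quot @idem_ideal F I})) | exact: VGpiM].
Qed.

HB.instance Definition _ :=
  GRing.isZmodMorphism.Build _ _ (@VGpi F I) VGpi_is_zmod_morphism.
HB.instance Definition _ :=
  GRing.isMonoidMorphism.Build _ _ (@VGpi F I) VGpi_is_monoid_morphism.

Definition sign_point d (i : 'I_#|I|) : F := (d (enum_val i))%:R.

(** The value at $d$ of the function represented by $x$; by [VGev_pi] any other representative gives
    the same value. *)
Definition VGev d x : F := meval (sign_point d) (repr x).

(** The relations $e^2-e$ vanish at every point with coordinates $0$ and $1$, hence so does the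
    ideal they generate. *)
Lemma VGev_pi d p : VGev d (VGpi p) = meval (sign_point d) p.
Proof.
suff E q : q \in @idem_ideal F I -> meval (sign_point d) q = 0.
  apply/eqP; rewrite -subr_eq0 -mevalB; apply/eqP/E.
  by rewrite -VGpi_eq VGpiK.
move=> /asboolP.
apply: (ideal_gen_least (J := [set q | meval (sign_point d) q = 0])).
  split=> [|a u v /= u0 v0] /=; first exact: meval0.
  by rewrite mevalD mevalM u0 v0 mulr0 addr0.
move=> _ [H _ <-] /=; rewrite mevalB rmorphXn /= mevalXU.
by rewrite -natrX expnS expn1 mulnb andbb subrr.
Qed.

Lemma VGev_is_zmod_morphism d : zmod_morphism (VGev d).
Proof.
by move=> x y; rewrite -[x]VGpiK -[y]VGpiK -rmorphB !VGev_pi mevalB.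
Qed.

Lemma VGev_is_monoid_morphism d : monoid_morphism (VGev d).
Proof.
split; first by rewrite -(rmorph1 (@VGpi F I)) VGev_pi meval1.
by move=> x y; rewrite -[x]VGpiK -[y]VGpiK -rmorphM !VGev_pi mevalM.
Qed.

HB.instance Definition _ d :=
  GRing.isZmodMorphism.Build _ _ (VGev d) (VGev_is_zmod_morphism d).
HB.instance Definition _ d :=
  GRing.isMonoidMorphism.Build _ _ (VGev d) (VGev_is_monoid_morphism d).

Lemma VGevZ d (a : F) x : VGev d (a *: x) = a * VGev d x.
Proof. by rewrite -[x]VGpiK -VGpiZ !VGev_pi mevalZ. Qed.

Lemma VGev_e d H s : VGev d (VGe F H s) = (d H == s)%:R.
Proof.
have E : VGev d (VGpi (evar F H)) = (d H)%:R.
  by rewrite VGev_pi mevalXU /sign_point enum_rankK.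
case: s; rewrite /VGe /=; first by rewrite E; case: (d H).
by rewrite rmorphB rmorph1 /= E; case: (d H); rewrite ?subrr ?subr0.
Qed.

Lemma VGev_f d S e : VGev d (VGf F S e) = [forall H in S, d H == e H]%:R.
Proof.
rewrite rmorph_prod /=; under eq_bigr do rewrite VGev_e.
case: forall_inP => [dS|/forall_inP/forall_inPn[H HS /negPf dH]].
  by rewrite big1 // => H HS; rewrite dS.
by rewrite (bigD1 H) //= dH mul0r.
Qed.

Local Notation "\1_ d" := (VGf F [set: I] d) (at level 8).

Lemma VGev_indic d e : VGev d \1_e = (d == e)%:R.
Proof.
rewrite VGev_f; congr (nat_of_bool _)%:R.
apply/forall_inP/eqP => [de|-> //].
by apply/ffunP => H; apply/eqP/de; rewrite inE.
Qed.

Lemma VGe_idem H s : VGe F H s * VGe F H s = VGe F H s.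
Proof.
have E : VGpi (evar F H) * VGpi (evar F H) = VGpi (evar F H) :> VGR.
  rewrite -VGpiM -expr2; apply/eqP; rewrite VGpi_eq.
  by apply/asboolP; apply: ideal_gen_sub; exists H.
by case: s => //=; rewrite mulrBl !mulrBr !mul1r mulr1 E subrr subr0.
Qed.

Lemma VGe_evar d H :
  VGpi (evar F H) * VGe F H (d H) = (d H)%:R *: VGe F H (d H).
Proof.
have := VGe_idem H true; case: (d H) => /= E; first by rewrite scale1r.
by rewrite mulrBr mulr1 E subrr scale0r.
Qed.

(** The product $f_{\mathcal{A}}^d$ contains the factor $e_H^{d_H}$, so it is an eigenvector of
    multiplication by each variable $e_H^+$, with eigenvalue $1$ or $0$ according to $d_H$. This
    extends to monomials and then to polynomials. *)
Lemma VGpi_indic d p : VGpi p * \1_d = meval (sign_point d) p *: \1_d.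
Proof.
have EX i : VGpi (mpolyX F (mnm1 i)) * \1_d = sign_point d i *: \1_d.
  rewrite /VGf (bigD1 (enum_val i)) ?inE //= mulrA scalerAl; congr (_ * _).
  by rewrite -[X in mnm1 X]enum_valK; exact: VGe_evar.
elim/mpolyind: p => [|c m p _ _ IH]; first
  by rewrite rmorph0 mul0r meval0 scale0r.
rewrite rmorphD /= mulrDl IH mevalD scalerDl; congr (_ + _).
rewrite VGpiZ mevalZ -scalerAl -scalerA; congr (_ *: _) => {p IH}.
(* The monomial is split into powers of variables, and the eigenvalues are multiplied up one factor
   at a time. *)
rewrite mpolyXE_id !rmorph_prod /=.
apply: (big_rec2 (fun u a => u * \1_d = a *: \1_d)) => [|i a u _ IH].
  by rewrite mul1r scale1r.
rewrite -mulrA IH -scalerAr !rmorphXn /= mevalXU.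
rewrite (mulrC _ u) -scalerA; congr (_ *: _).
elim: (m i) => [|n IHn]; first by rewrite !expr0 mul1r scale1r.
by rewrite exprSr -mulrA EX -scalerAr IHn scalerA exprS.
Qed.

Lemma indic_scale d x : x * \1_d = VGev d x *: \1_d.
Proof. by rewrite -{1}[x]VGpiK VGpi_indic. Qed.

(** Expand $\prod_H(e_H^+ + e_H^-)$, all of whose factors are $1$. *)
Lemma sum_indic : \sum_d \1_d = 1 :> VGR.
Proof.
have E d : \1_d = \prod_H VGe F H (d H) by apply: eq_bigl => H; rewrite inE.
rewrite (eq_bigr _ (fun d _ => E d)).
rewrite -(bigA_distr_bigA (fun H s => VGe F H s)) big1 // => H _.
by rewrite big_bool /= addrC subrK.
Qed.

Lemma VGring_decomp x : x = \sum_d VGev d x *: \1_d.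
Proof.
rewrite -[LHS]mulr1 -sum_indic big_distrr.
by apply: eq_bigr => d _; exact: indic_scale.
Qed.

Lemma VGring_ext x y : (forall d, VGev d x = VGev d y) -> x = y.
Proof.
move=> xy; rewrite (VGring_decomp x) (VGring_decomp y).
by apply: eq_bigr => d _; rewrite xy.
Qed.

End VGring.

(** * The ideals $I_k$ as vanishing ideals of $\Sigma_k$, and the dimension of the quotients *)

Section VG.
Variables (V : Type) (I : finType) (half : I -> bool -> set V) (F : fieldType).
Hypothesis V0 : inhabited V.
(** The form in which the symmetry $v\mapsto -v$ enters the algebra. *)
Hypothesis halfN : forall S eps, half_inter half S eps !=set0 ->
  half_inter half S [ffun H => ~~ eps H] !=set0.
Local Notation sign := {ffun I -> bool}.
Local Notation VGR := (VGring F I).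
Local Notation "\1_ d" := (VGf F [set: I] d) (at level 8).
Implicit Types (d e : sign) (x y : VGR) (S : {set I}).

Lemma eq_half_inter S d e : {in S, d =1 e} ->
  half_inter half S d = half_inter half S e.
Proof. by move=> de; apply: eq_bigcapr => H HS; rewrite de. Qed.

Lemma in_Sigma k d : reflect (consistent half k d) (d \in Sigma half k).
Proof. by rewrite inE; exact: asboolP. Qed.

Lemma VG_idealP k x :
  VG_ideal half F k x <-> forall d, d \in Sigma half k -> VGev d x = 0.
Proof.
split=> [xI d /in_Sigma dk|xS].
  apply: (ideal_gen_least (J := [set y | VGev d y = 0])) xI.
    split=> [|a u v /= u0 v0] /=; first exact: rmorph0.
    by rewrite rmorphD rmorphM /= u0 v0 mulr0 addr0.
  move=> _ [S [e [eS Sk ->]]] /=; rewrite rmorphB /= !VGev_f.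
  have out e' : half_inter half S e' = set0 ->
      [forall H in S, d H == e' H] = false.
    move=> e0; apply/negP => /forall_inP de.
    have := dk _ Sk; rewrite (eq_half_inter (e := e')) ?e0 => [[]//|H HS].
    exact/eqP/de.
  (* If $H_S^{-e}$ were nonempty, negating once more would make $H_S^e$ nonempty. *)
  rewrite !out ?subrr //; apply: contrapT => /eqP/set0P/halfN.
  rewrite (eq_half_inter (e := e)) => [[v]|H _]; last by rewrite !ffunE negbK.
  by rewrite eS.
rewrite (VGring_decomp x); apply: ideal_gen_sum => d _.
have [/xS ->|] := boolP (d \in Sigma half k).
  by rewrite scale0r; case: (ideal_gen_ideal (VG_relations half F k)).
move=> /in_Sigma /existsNP[S /not_implyP[Sk /set0P/negP/negPn/eqP dS]].
(* Here $f_{\mathcal{A}}^d g_S^d=f_{\mathcal{A}}^d$, with $S$ witnessing that $d$ is not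
   $k$-consistent. *)
rewrite (_ : _ *: _ = (VGev d x *: \1_d) * VGg F S d).
  by apply: ideal_genM; apply: ideal_gen_sub; exists S, d.
(* The intersection over the empty set is all of $V$, so $S$ is nonempty. An element of $S$ makes
   $f_S^{-d}$ vanish at $d$. *)
have [H HS] : exists H, H \in S.
  apply/set0Pn; apply: contra_eq_neq dS => ->; case: V0 => v.
  by apply/set0P; exists v; move=> H /=; rewrite inE.
apply: VGring_ext => e; rewrite rmorphM rmorphB /= VGevZ VGev_indic !VGev_f.
have [->|_] := eqVneq e d; last by rewrite mulr0 mul0r.
have -> : [forall H in S, d H == d H] by apply/forall_inP.
have /negPf-> : ~~ [forall H in S, d H == [ffun H => ~~ d H] H].
  by apply/forall_inPn; exists H; rewrite // ffunE; case: (d H).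
by rewrite /= subr0 !mulr1.
Qed.

(** This recovers $\Sigma_k$ from $I_k$. *)
Lemma indic_VG_ideal k d : VG_ideal half F k \1_d <-> d \notin Sigma half k.
Proof.
rewrite VG_idealP; split=> [dI|dS e eS].
  by apply/negP => /dI/eqP; rewrite VGev_indic eqxx oner_eq0.
by rewrite VGev_indic; case: eqP eS => // -> /(negP dS).
Qed.

Lemma VG_ideal_eq k l :
  VG_ideal half F k = VG_ideal half F l <-> Sigma half k = Sigma half l.
Proof.
split=> [E|E]; last by apply/seteqP; split=> x; rewrite !VG_idealP E.
apply/setP => d; apply: negb_inj; apply/idP/idP => /indic_VG_ideal.
  by rewrite E => /indic_VG_ideal.
by rewrite -E => /indic_VG_ideal.
Qed.

Lemma Sigma_anti k l : (k <= l)%N -> Sigma half l \subset Sigma half k.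
Proof.
move=> kl; apply/fintype.subsetP => d /in_Sigma dl; apply/in_Sigma => S Sk.
by apply: dl; exact: leq_trans Sk _.
Qed.

(** One of the two sets contains the other, so equal cardinality forces equality. *)
Lemma sigma_eq k l :
  sigma half k = sigma half l <-> Sigma half k = Sigma half l.
Proof.
rewrite /sigma; split=> [E|-> //].
have [kl|/ltnW lk] := leqP k l; last symmetry.
  by apply/esym/eqP; rewrite eqEcard Sigma_anti //= E.
by apply/esym/eqP; rewrite eqEcard Sigma_anti //= E.
Qed.

Lemma has_dim_VG k : has_dim (VG half F k) (sigma half k).
Proof.
pose Q := VG half F k.
(* Classes modulo $I_k$ are functions restricted to $\Sigma_k$. *)
have pi_eq (x y : VGR) : (\pi_Q x == \pi_Q y) =
    [forall d in Sigma half k, VGev d x == VGev d y].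
  have := Quotient.idealrBE (ideal_pred (VG_relations half F k)) x y.
  move=> /esym ->; apply/asboolP/forall_inP => [/VG_idealP xy d /xy|xy].
    by rewrite rmorphB /= => /eqP; rewrite subr_eq0.
  by apply/VG_idealP => d /xy /eqP; rewrite rmorphB /= => ->; rewrite subrr.
pose sg (i : 'I_(sigma half k)) : sign := enum_val i.
pose b i : Q := \pi_Q \1_(sg i).
have piZ a (y : VGR) : \pi_Q (a *: y) = a *: (\pi_Q y : Q).
  exact: (pi_scale (@VG_idealZ _ _ half F k)).
have bE (c : {ffun 'I_(sigma half k) -> F}) :
    \sum_i c i *: b i = \pi_Q (\sum_i c i *: \1_(sg i)).
  rewrite (raddf_sum (\pi_Q)); apply: eq_bigr => i _.
  exact/esym/piZ.
have evE (c : {ffun 'I_(sigma half k) -> F}) i :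
    VGev (sg i) (\sum_j c j *: \1_(sg j)) = c i.
  rewrite rmorph_sum (bigD1 i) //= big1 => [|j ji].
    by rewrite addr0 VGevZ VGev_indic eqxx mulr1.
  by rewrite VGevZ VGev_indic (inj_eq enum_val_inj) eq_sym (negPf ji) mulr0.
(* The coordinates of a class are the values of a representative on $\Sigma_k$; by [evE] no other
   coefficients are possible. *)
exists b => x; exists [ffun i => VGev (sg i) (repr x)]; split.
  rewrite bE -[LHS]reprK; apply/eqP; rewrite pi_eq; apply/forall_inP => d dS.
  have -> : d = sg (enum_rank_in dS d) by rewrite /sg enum_rankK_in.
  by rewrite evE ffunE.
move=> c xc; apply/ffunP => i; rewrite ffunE -(evE c i); apply/eqP.
have /eqP := xc; rewrite bE -[X in X == _]reprK pi_eq => /forall_inP; apply.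
exact: enum_valP.
Qed.

End VG.

Local Close Scope quotient_scope.
Local Close Scope ring_scope.
Local Close Scope classical_set_scope.

Theorem theorem2p4 (R : realType) (V : vectType R) (r : nat)
    (A : {fset {vspace V}}) (half : A -> bool -> set V) (F : fieldType)
    (dimV : \dim {:V} = r)
    (hyperplanes : forall H : {vspace V}, H \in A -> (\dim H).+1 = r)
    (essential : (\bigcap_(H <- A) H)%VS = 0%VS)
    (coor : coorientation half) :
  (forall k : nat, 1 <= k -> has_dim (VG half F k) (sigma half k)) /\
  (yoshinaga half r <-> VG_ideal half F 2 = VG_ideal half F r).
Proof.
move: hyperplanes; rewrite -dimV => {}hyperplanes.
have halfN S eps : (half_inter half S eps !=set0 ->
    half_inter half S [ffun H => ~~ eps H] !=set0)%classic.
  move=> [v Sv]; exists (- v)%R => H HS; rewrite ffunE.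
  by apply: half_opp => //; exact: Sv.
have V0 : inhabited V := inhabits 0%R.
split=> [k _|]; first exact: has_dim_VG.
(* Both sides of the equivalence say that $\Sigma_2=\Sigma_r$. *)
by rewrite (VG_ideal_eq F V0 halfN) -sigma_eq dimV.
Qed.
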